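(* Let $X$ be a convex domain equipped with a proximal setup (norm $\|\cdot\|$, distance-generating function $\omega$, Bregman distance $V$, prox-mapping $\mathrm{Prox}$, $\omega$-center $x_\omega$, set width $\Omega$). Let $T\ge1$, let $f_t:X\to\mathbb{R}$, $t\in[T]$, be convex, and suppose there exists $L\in(0,\infty)$ such that $\|\nabla f_t(x)-\nabla f_t(v)\|_*\le L\|x-v\|$ for all $x,v\in X$ and all $t\in[T]$. Let $\theta\in\Delta_T$. Set $v_1:=x_\omega$ and for $t=1,\dots,T$ let $$x_t:=\mathrm{Prox}_{v_t}(\gamma_t\theta_t\nabla f_t(v_t)),\qquad v_{t+1}:=\mathrm{Prox}_{v_t}(\gamma_t\theta_t\nabla f_t(x_t)),$$ with step sizes $\gamma_t=\frac{1}{L\sup_{s\in[T]}\theta_s}$ for all $t\in[T]$. Then $$\sum_{t=1}^{T}\theta_t f_t(x_t)-\inf_{x\in X}\sum_{t=1}^{T}\theta_t f_t(x)\ \le\ \Omega L\sup_{t\in[T]}\theta_t.$$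
   Context: $[T]=\{1,\dots,T\}$; $\Delta_T=\{\theta\in\mathbb{R}^T_+:\sum_{t}\theta_t=1\}$. $\nabla f_t(x)$ denotes a (selected) subgradient of $f_t$ at $x$ (the gradient if differentiable). Proximal setup for a convex domain $Z$ in a Euclidean space $E$ (here $Z=X$): (i) a norm $\|\cdot\|$ on $E$ with dual norm $\|\zeta\|_*=\max_{\|z\|\le 1}\langle\zeta,z\rangle$; (ii) a distance-generating function $\omega:Z\to\mathbb{R}$, convex and continuous on $Z$, admitting a selection of subgradients $\nabla\omega(z)$ that is continuous on $Z^\circ:=\{z\in Z:\partial\omega(z)\ne\emptyset\}$, and strongly convex with modulus 1: $\langle\nabla\omega(z')-\nabla\omega(z''),z'-z''\rangle\ge\|z'-z''\|^2$ for all $z',z''\in Z^\circ$; (iii) Bregman distance $V_z(z'):=\omega(z')-\omega(z)-\langle\nabla\omega(z),z'-z\rangle$ for $z\in Z^\circ$, $z'\in Z$; (iv) prox-mapping $\mathrm{Prox}_z(\xi):=\arg\min_{z'\in Z}\{\langle\xi,z'\rangle+V_z(z')\}$, a map $E\to Z^\circ$, for $z\in Z^\circ$; (v) $\omega$-center $z_\omega:=\arg\min_{z\in Z}\omega(z)$; (vi) set width $\Omega:=\max_{z\in Z}V_{z_\omega}(z)$. Existence of these minimizers and of the maximum is part of the setup. *)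

(* Defs.v *)
From HB Require Import structures.
From mathcomp Require Import all_boot all_order all_algebra.
From mathcomp Require Import all_classical all_reals all_analysis.
Import Order.TTheory GRing.Theory Num.Theory.
Import numFieldNormedType.Exports.

Set Implicit Arguments.
Unset Strict Implicit.
Unset Printing Implicit Defensive.

Local Open Scope classical_set_scope.
Local Open Scope ring_scope.

(* A Euclidean space is 'rV[R]_n with an arbitrary inner product [ip]. A
   real-valued function on a set X is a total function of which only the values
   on X are used; likewise a selection or a prox-mapping defined on a set is a
   total function. *)
Section ProximalSetup.
Context {R : realType} {n : nat}.
Local Notation E := 'rV[R]_n.
Variable ip : {dot E for idfun}.
Implicit Types (X : set E) (f : E -> R).

Record is_norm (N : E -> R) : Prop := {
  is_norm_triangle : forall x y, N (x + y) <= N x + N y;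
  is_norm_scale : forall (a : R) x, N (a *: x) = `|a| * N x;
  is_norm_eq0 : forall x, N x = 0 -> x = 0 }.

(* In finite dimension this supremum is a maximum. *)
Definition dual_norm (N : E -> R) (zeta : E) : R :=
  sup [set ip zeta z | z in [set z | N z <= 1]].

Definition is_subgradient X f (x g : E) : Prop :=
  forall y, X y -> f x + ip g (y - x) <= f y.

Definition subdiff_dom X f : set E :=
  [set x | X x /\ exists g, is_subgradient X f x g].

Definition argmin X f : set E :=
  [set x | X x /\ forall y, X y -> f x <= f y].

Definition is_max (A : set R) (m : R) : Prop := A m /\ ubound A m.

Definition bregman (omega : E -> R) (domega : E -> E) (z z' : E) : R :=
  omega z' - omega z - ip (domega z) (z' - z).

(* [dgf] is the distance-generating function and [ddgf] its subgradient selection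
   on [subdiff_dom X dgf]. *)
Record proximal_setup X := ProximalSetup {
  pnorm : E -> R;
  dgf : E -> R;
  ddgf : E -> E;
  prox : E -> E -> E;
  omega_center : E;
  set_width : R;
  pnorm_norm : is_norm pnorm;
  dgf_convex : convex_function X dgf;
  dgf_continuous : {within X, continuous dgf};
  ddgf_subgradient : forall z,
    subdiff_dom X dgf z -> is_subgradient X dgf z (ddgf z);
  ddgf_continuous : {within subdiff_dom X dgf, continuous ddgf};
  ddgf_strong : forall z' z'',
    subdiff_dom X dgf z' -> subdiff_dom X dgf z'' ->
    pnorm (z' - z'') ^+ 2 <= ip (ddgf z' - ddgf z'') (z' - z'');
  prox_subdiff_dom : forall z xi,
    subdiff_dom X dgf z -> subdiff_dom X dgf (prox z xi);
  prox_argmin : forall z xi, subdiff_dom X dgf z ->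
    argmin X (fun z' => ip xi z' + bregman dgf ddgf z z') (prox z xi);
  omega_center_argmin : argmin X dgf omega_center;
  set_width_max : is_max [set bregman dgf ddgf omega_center z | z in X] set_width }.

End ProximalSetup.

Definition simplex {R : realType} (T : nat) : set ('I_T -> R) :=
  [set theta | (forall t, 0 <= theta t) /\ \sum_(t < T) theta t = 1].

(* Main.v *)
Require Import Defs.
From HB Require Import structures.
From mathcomp Require Import all_boot all_order all_algebra.
From mathcomp Require Import all_classical all_reals all_analysis.
From mathcomp Require Import ring lra.
Import Order.TTheory GRing.Theory Num.Theory.
Import numFieldNormedType.Exports.

(** The bound is the mirror-prox regret estimate. Each pair of prox steps satisfies
    [gamma_t theta_t <grad f_t(x_t), x_t - u> <= V_{v_t}(u) - V_{v_{t+1}}(u)]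
    ([extragradient_step]): the two prox optimality conditions leave an error
    [<xi' - xi, x_t - v_{t+1}>], which the Lipschitz condition bounds by
    [|x_t - v_t| |x_t - v_{t+1}|] because [gamma_t theta_t L <= 1], and which is
    compensated by [V_{v_t}(x_t) + V_{x_t}(v_{t+1})] since [V_z(u) >= |u - z|^2 / 2].
    Convexity bounds [f_t(x_t) - f_t(u)] by the left-hand side, the constant step
    [1 / (L sup theta)] factors out of the sum, and the Bregman terms telescope to
    at most [V_{v_1}(u) <= Omega].

    Most of the work is to obtain from the axioms of a proximal setup the two facts
    about [omega] used above. They are delicate because [X] need be neither closed
    nor full-dimensional, and [omega] may have several subgradients at a point, or
    none.
    - The prox point satisfies the variational inequality for the selected
      subgradient, not just for some subgradient ([subgradient_le_ddgf]). This
      follows from monotonicity and continuity of the selection once the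
      subdifferential domain is known to be dense in [X].
    - [V_z(u) >= |u - z|^2 / 2] ([bregman_ge]), although strong monotonicity of the
      selection is assumed only on the subdifferential domain, which need not
      contain the segment from [z] to [u].
    Both rest on [subgradient_near]: near a relative interior point [y] there is a
    point [w] with a subgradient [g] such that [<g, y - w> >= 0]. It is found by
    minimizing [omega] plus a large multiple of the squared distance to [y] over a
    compact piece of the affine hull of [X]. The sign condition allows integrating
    strong monotonicity along segments of the relative interior without any bound
    on the subgradients met there. *)

Set Implicit Arguments.
Unset Strict Implicit.
Unset Printing Implicit Defensive.

Local Open Scope classical_set_scope.
Local Open Scope ring_scope.

(** * Inner products on row vectors *)

Section InnerProduct.
Context {R : realType} {n : nat} (ip : {dot 'rV[R]_n for idfun}).
Implicit Types x y z : 'rV[R]_n.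

Lemma ipC x y : ip x y = ip y x.
Proof. by rewrite [LHS](@hermitian_subproof _ _ _ _ ip)/= expr0 mul1r. Qed.

Lemma ip_addl x y z : ip (x + y) z = ip x z + ip y z.
Proof. by rewrite linearDl. Qed.
Lemma ip_addr x y z : ip x (y + z) = ip x y + ip x z.
Proof. by rewrite linearDr. Qed.
Lemma ip_oppl x y : ip (- x) y = - ip x y.
Proof. by rewrite linearNl. Qed.
Lemma ip_oppr x y : ip x (- y) = - ip x y.
Proof. by rewrite linearNr. Qed.
Lemma ip_scalel a x y : ip (a *: x) y = a * ip x y.
Proof. by rewrite linearZl_LR. Qed.
Lemma ip_scaler a x y : ip x (a *: y) = a * ip x y.
Proof. by rewrite linearZr_LR. Qed.
Lemma ip0l x : ip 0 x = 0.
Proof. by rewrite linear0l. Qed.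
Lemma ip0r x : ip x 0 = 0.
Proof. by rewrite linear0r. Qed.

Definition ipE := (ip_addl, ip_addr, ip_oppl, ip_oppr, ip_scalel, ip_scaler).

Lemma ip_sum_coord x y :
  ip x y = \sum_(i < n) \sum_(j < n) x 0 i * (y 0 j * ip 'e_i 'e_j).
Proof.
rewrite {1}(row_sum_delta x) linear_sumlz; apply: eq_bigr => i _.
rewrite {1}(row_sum_delta y) linear_sumr; apply: eq_bigr => j _.
by rewrite /= ip_scaler ip_scalel mulrCA.
Qed.

(** An arbitrary inner product is a polynomial in the coordinates, hence jointly
    continuous for the sup norm that carries the topology of row vectors. *)
Lemma cvg_ip (T : Type) (F : set_system T) {FF : Filter F}
    (u v : T -> 'rV[R]_n) x y :
  u @ F --> x -> v @ F --> y -> (fun t => ip (u t) (v t)) @ F --> ip x y.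
Proof.
move=> ux vy.
have coord w z i : w @ F --> z -> (fun t => w t 0 i) @ F --> (z : 'rV[R]_n) 0 i.
  by move=> wz; exact: (cvg_comp _ _ wz (@coord_continuous _ _ _ 0 i z)).
under eq_fun do rewrite ip_sum_coord.
rewrite ip_sum_coord; apply: cvg_big; first exact: add_continuous.
move=> i _; apply: cvg_big; first exact: add_continuous.
move=> j _; apply: cvgM; first exact: coord.
by apply: cvgM; [exact: coord|exact: cvg_cst].
Qed.

End InnerProduct.

(** * Arbitrary norms in finite dimension *)

Section Norms.
Context {R : realType} {m : nat}.
Implicit Types (N : 'rV[R]_m -> R) (a b x : 'rV[R]_m).

Lemma coord_le_norm x i : `|x 0 i| <= `|x|.
Proof.
rewrite [leRHS]/Num.norm /= mx_normrE.
exact: (le_bigmax _ (fun k : 'I_1 * 'I_m => `|x k.1 k.2|) (0, i)).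
Qed.

Lemma seminorm_le_norm N :
  (forall x y, N (x + y) <= N x + N y) ->
  (forall c x, N (c *: x) = `|c| * N x) ->
  exists2 C, 0 < C & forall x, N x <= C * `|x|.
Proof.
move=> ND NZ.
have N0 : N 0 = 0 by rewrite -[X in N X](scale0r 0) NZ normr0 mul0r.
have Nge0 x : 0 <= N x.
  have := ND x (- x); rewrite subrr N0 -scaleN1r NZ normrN1 mul1r.
  by rewrite -mulr2n pmulrn_lge0.
have Nsum x : N x <= \sum_(i < m) `|x 0 i| * N 'e_i.
  rewrite {1}(row_sum_delta x).
  elim/big_ind2 : _ => [|u s v t us vt|i _]; first by rewrite N0.
    by rewrite (le_trans (ND _ _))// lerD.
  by rewrite NZ.
exists (1 + \sum_(i < m) N 'e_i).
  by rewrite ltr_pwDl// sumr_ge0.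
move=> x; apply: le_trans (Nsum x) _.
rewrite mulrDl mul1r -[leLHS]add0r lerD// mulr_suml ler_sum// => i _.
by rewrite mulrC ler_wpM2l// coord_le_norm.
Qed.

Lemma closed_ball_compact (r : R) : compact [set a : 'rV[R]_m | `|a| <= r].
Proof.
apply: bounded_closed_compact.
  exists r; split; first exact: num_real.
  by move=> s rs a /= /le_trans; apply; exact: ltW.
apply: (@closed_comp _ _ (fun a : 'rV[R]_m => `|a|) [set s | s <= r]).
  by move=> a _; exact: norm_continuous.
exact: closed_le.
Qed.

(** Compactness of the sphere turns pointwise positivity into a uniform bound.
    The sphere is empty in dimension 0, where any constant works. *)
Lemma sphere_lower_bound (q : 'rV[R]_m -> R) (r : R) :
  continuous q -> (forall a, a != 0 -> 0 < q a) -> 0 < r ->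
  exists2 k, 0 < k & forall a, `|a| = r -> k <= q a.
Proof.
move=> cq q_gt0 r_gt0.
pose S := [set a : 'rV[R]_m | `|a| = r].
have cS : compact S.
  apply: (subclosed_compact _ (@closed_ball_compact r)); last first.
    by move=> a /= ->.
  apply: (@closed_comp _ _ (fun a : 'rV[R]_m => `|a|) [set r]).
    by move=> a _; exact: norm_continuous.
  exact: closed_eq.
have [S0|S0] := eqVneq S set0.
  by exists 1 => // a ar; have : S a by []; rewrite S0.
have [||a] := @compact_EVT_min _ R q S _ cS; first by apply/set0P.
  exact: continuous_subspaceT.
rewrite inE /S/= => ar amin; exists (q a).
  by apply: q_gt0; rewrite -normr_gt0 ar.
by move=> b br; apply: amin; rewrite inE.
Qed.

Lemma is_norm0 N : is_norm N -> N 0 = 0.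
Proof. by case=> _ NZ _; rewrite -[X in N X](scale0r 0) NZ normr0 mul0r. Qed.

Lemma is_normN N x : is_norm N -> N (- x) = N x.
Proof. by case=> _ NZ _; rewrite -scaleN1r NZ normrN1 mul1r. Qed.

Lemma is_norm_ge0 N x : is_norm N -> 0 <= N x.
Proof.
move=> nN; have := is_norm_triangle nN x (- x).
by rewrite subrr is_norm0// is_normN// -mulr2n pmulrn_lge0.
Qed.

Lemma is_norm_continuous N : is_norm N -> continuous N.
Proof.
move=> nN; have [ND NZ _] := nN.
have [C C_gt0 NC] := seminorm_le_norm ND NZ.
have NB x y : `|N x - N y| <= N (x - y).
  have h u w : N u - N w <= N (u - w) by rewrite lerBlDr -{1}(subrK w u) ND.
  by rewrite ler_norml h andbT lerNl opprB (le_trans (h _ _))// -opprB is_normN.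
move=> x; apply/(@cvgrPdist_le _ R^o _ (nbhs x) (nbhs_filter x)) => /= e e_gt0.
near=> y; rewrite (le_trans (NB _ _))// (le_trans (NC _))//.
rewrite -ler_pdivlMl//; near: y.
have /cvgrPdist_le xx : (fun y : 'rV[R]_m => y) @ x --> x by exact: cvg_id.
by apply: xx; rewrite mulr_gt0 ?invr_gt0.
Unshelve. all: by end_near. Qed.

(** This half of the equivalence of norms makes the set whose supremum is the
    dual norm bounded; an unbounded set would have the junk supremum 0. *)
Lemma is_norm_lower_bound N : is_norm N ->
  exists2 k, 0 < k & forall x, k * `|x| <= N x.
Proof.
move=> nN; have [_ NZ N0] := nN.
have [|k k_gt0 kN] := @sphere_lower_bound N 1 (is_norm_continuous nN) _ ltr01.
  by move=> a; rewrite lt_def is_norm_ge0// andbT; apply: contra_neq => /N0.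
exists k => // x.
have [->|x0] := eqVneq x 0; first by rewrite normr0 mulr0 is_norm_ge0.
have nx : 0 < `|x| by rewrite normr_gt0.
have := kN (`|x|^-1 *: x).
rewrite normrZ normfV normr_id mulVf ?gt_eqF// => /(_ erefl).
by rewrite NZ gtr0_norm ?invr_gt0// ler_pdivlMl// mulrC.
Qed.

Lemma mulmxr_le_norm n (A : 'M[R]_(m, n)) :
  exists2 C, 0 < C & forall a : 'rV[R]_m, `|a *m A| <= C * `|a|.
Proof.
apply: (@seminorm_le_norm (fun a => `|a *m A|)) => [a b|c a].
  by rewrite mulmxDl ler_normD.
by rewrite -scalemxAl normrZ.
Qed.

Lemma continuous_mulmxr n (A : 'M[R]_(m, n)) :
  continuous (fun a : 'rV[R]_m => a *m A).
Proof.
have [C C_gt0 AC] := mulmxr_le_norm A.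
move=> a; apply/(@cvgrPdist_le _ _ _ (nbhs a) (nbhs_filter a)) => /= e e_gt0.
near=> b; rewrite -mulmxBl (le_trans (AC _))//.
rewrite -ler_pdivlMl//; near: b.
have /cvgrPdist_le aa : (fun y : 'rV[R]_m => y) @ a --> a by exact: cvg_id.
by apply: aa; rewrite mulr_gt0 ?invr_gt0.
Unshelve. all: by end_near. Qed.

End Norms.

Lemma dual_norm_bound {R : realType} {n : nat} (ip : {dot 'rV[R]_n for idfun})
    (M : 'rV[R]_n -> R) (zeta d : 'rV[R]_n) : is_norm M ->
  ip zeta d <= dual_norm ip M zeta * M d.
Proof.
move=> nM; have [k k_gt0 kM] := is_norm_lower_bound nM.
have [C C_gt0 zC] : exists2 C, 0 < C & forall x, `|ip zeta x| <= C * `|x|.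
  apply: (@seminorm_le_norm _ _ (fun x => `|ip zeta x|)) => [x y|c x].
    by rewrite ip_addr ler_normD.
  by rewrite ip_scaler normrM.
have [->|d0] := eqVneq d 0; first by rewrite ip0r is_norm0// mulr0.
have Md : 0 < M d by rewrite (lt_le_trans _ (kM d))// mulr_gt0// normr_gt0.
rewrite -ler_pdivrMr// mulrC -ip_scaler; apply: sup_upper_bound; last first.
  exists ((M d)^-1 *: d) => //=.
  by rewrite (is_norm_scale nM) gtr0_norm ?invr_gt0// mulVf ?gt_eqF.
split; first by exists (ip zeta 0), 0 => //=; rewrite is_norm0.
exists (C * k^-1) => _ [x /= x1 <-].
rewrite (le_trans (ler_norm _))// (le_trans (zC x))// ler_pM2l//.
by rewrite -[k^-1]mulr1 ler_pdivlMl// (le_trans (kM x)).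
Qed.

(** * Relative interior of a convex set *)

Section ConvexSets.
Context {R : realType} {n : nat} (X : set 'rV[R]_n) (convX : convex_set X).
Implicit Types x y c : 'rV[R]_n.

Lemma convex_set_segment x y (t : R) :
  0 <= t <= 1 -> X x -> X y -> X ((1 - t) *: x + t *: y).
Proof.
move=> /andP[t0 t1] Xx Xy.
have /set_mem := convX (Itv01 t0 t1) (mem_set Xy) (mem_set Xx).
by rewrite addrC.
Qed.

Lemma convex_function_segment (f : 'rV[R]_n -> R) x y (t : R) :
  convex_function X f -> 0 <= t <= 1 -> X x -> X y ->
  f ((1 - t) *: x + t *: y) <= (1 - t) * f x + t * f y.
Proof.
move=> cf /andP[t0 t1] Xx Xy.
have h := cf (Itv01 t0 t1) _ _ (mem_set Xy) (mem_set Xx).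
by rewrite [X in f X]addrC [leRHS]addrC; exact: h.
Qed.

(** When the rows of [A] form a basis of the direction space of the affine hull
    of [X], these are the points of the relative interior of [X]; the basis is
    kept explicit so that neighbourhoods become balls of ['rV_m], which are
    compact. *)
Definition rel_interior m (A : 'M[R]_(m, n)) y :=
  exists2 r, 0 < r & forall a : 'rV[R]_m, `|a| <= r -> X (y + a *m A).

Lemma rel_interior_sub m (A : 'M[R]_(m, n)) y : rel_interior A y -> X y.
Proof.
by move=> [r r0 /(_ 0)]; rewrite mul0mx addr0 normr0; apply; exact: ltW.
Qed.

Lemma rel_interior_segment m (A : 'M[R]_(m, n)) c x (t : R) :
  rel_interior A c -> X x -> 0 < t <= 1 ->
  rel_interior A ((1 - t) *: x + t *: c).
Proof.
move=> [r r_gt0 cr] Xx /andP[t_gt0 t_le1]; exists (t * r); first exact: mulr_gt0.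
move=> a ar.
have -> : (1 - t) *: x + t *: c + a *m A
    = (1 - t) *: x + t *: (c + (t^-1 *: a) *m A).
  by rewrite scalerDr -scalemxAl scalerA divff ?gt_eqF// scale1r addrA.
apply: convex_set_segment => //; first by rewrite ltW.
apply: cr; rewrite normrZ gtr0_norm ?invr_gt0//.
by rewrite ler_pdivrMl.
Qed.

(** Take a largest free family [A] admitting a point [c] around which [X] contains
    a ball of [c + span A]. If some [x] in [X] were outside [c + span A], then
    [x - c] could be added to the family, with the midpoint of [c] and [x] as
    centre: near it, points are convex combinations of [x] and of points near
    [c]. *)
Lemma exists_rel_interior : X !=set0 ->
  exists m (A : 'M[R]_(m, n)) c, [/\ row_free A, rel_interior A c
    & forall x y, X x -> X y -> (x - y <= A)%MS].
Proof.
move=> [x0 Xx0].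
pose P m := `[< exists (A : 'M[R]_(m, n)) c, row_free A /\ rel_interior A c >].
have exP : exists m, P m.
  exists 0%N; apply/asboolP; exists 0, x0; split.
    by rewrite /row_free mxrank0.
  by exists 1 => // a _; rewrite mulmx0 addr0.
have leP m : P m -> (m <= n)%N.
  by move=> /asboolP[A [c [/eqP rkA _]]]; have := rank_leq_col A; rewrite rkA.
case: (ex_maxnP exP leP) => m /asboolP[A [c [freeA rA]]] maxm.
exists m, A, c; split=> //.
suff XA x : X x -> (x - c <= A)%MS.
  move=> x y Xx Xy; rewrite -(subrK c x) -addrA addmx_sub ?XA//.
  by rewrite -opprB eqmx_opp XA.
move=> Xx; apply/negPn/negP => xA.
have [r r_gt0 cr] := rA.
suff /maxm : P (m + 1)%N by rewrite addn1 ltnn.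
apply/asboolP; exists (col_mx A (x - c)), (2^-1 *: (c + x)); split.
  apply: inj_row_free => v; rewrite -(hsubmxK v) mul_row_col.
  set a := lsubmx v; set b := rsubmx v.
  rewrite (mx11_scalar b) mul_scalar_mx => /eqP; rewrite addr_eq0 => /eqP aA.
  have b0 : b 0 0 = 0.
    apply: contraNeq xA => b0; rewrite -(scale1r (x - c)) -(mulVf b0) -scalerA.
    by rewrite scalemx_sub// -[_ *: _]opprK -aA eqmx_opp submxMl.
  move: aA; rewrite b0 scale0r oppr0 => aA.
  have /eqP -> : a == 0 by rewrite -(mulmx_free_eq0 _ freeA) aA.
  by rewrite raddf0 row_mx0.
(* [4^-1] keeps the weight [1/2 - s] of the point near [c] above [4^-1], so that
   dividing by it costs at most the factor 4 allowed by [r / 4]. *)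
exists (Num.min 4^-1 (r / 4)); first by rewrite lt_min invr_gt0 ltr0n divr_gt0.
move=> v; rewrite -(hsubmxK v) mul_row_col.
set a := lsubmx v; set b := rsubmx v.
rewrite le_min => /andP[v1 v2].
have bv : `|b 0 0| <= 4^-1.
  rewrite (le_trans _ v1)//; apply: le_trans (coord_le_norm _ (rshift m 0)).
  by rewrite row_mxEr.
have av : `|a| <= r / 4.
  rewrite [leLHS]/Num.norm /= mx_normrE; apply/bigmax_leP; split.
    by rewrite divr_ge0 ?ltW.
  move=> [i j] _ /=; rewrite (le_trans _ v2)// ord1.
  by apply: le_trans (coord_le_norm _ (lshift 1 j)); rewrite row_mxEl.
rewrite (mx11_scalar b) mul_scalar_mx.
move: bv; rewrite ler_norml => /andP[b1 b2].
set s := b 0 0 in b1 b2 *.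
have s0 : 0 < 2^-1 - s by lra.
have -> : 2^-1 *: (c + x) + (a *m A + s *: (x - c)) =
    (1 - (2^-1 + s)) *: (c + ((2^-1 - s)^-1 *: a) *m A) + (2^-1 + s) *: x.
  have -> : 1 - (2^-1 + s) = 2^-1 - s by lra.
  rewrite [in RHS]scalerDr -scalemxAl scalerA divff ?gt_eqF// scale1r.
  by move: (a *m A) => w; apply/rowP => j; rewrite !mxE; ring.
apply: convex_set_segment => //; first by lra.
apply: cr; rewrite normrZ gtr0_norm ?invr_gt0//.
rewrite ler_pdivrMl// (le_trans av)//.
by rewrite mulrC; apply: ler_wpM2r; [exact: ltW|lra].
Qed.

End ConvexSets.

(** * Subgradients near relative interior points *)

Lemma ge0_of_small_slope {R : realFieldType} (D K t0 : R) : 0 < t0 ->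
  (forall t, 0 < t <= t0 -> 0 <= D + t * K) -> 0 <= D.
Proof.
move=> t0_gt0 h; rewrite leNgt; apply/negP => D_lt0.
have K1 : 0 < `|K| + 1 by rewrite ltr_wpDl.
pose t := Num.min t0 (- D / (`|K| + 1)).
have t_gt0 : 0 < t by rewrite lt_min t0_gt0 divr_gt0 // oppr_gt0.
have /h : 0 < t <= t0 by rewrite t_gt0 ge_min lexx.
apply/negP; rewrite -ltNge.
have tD : t * (`|K| + 1) <= - D by rewrite -ler_pdivlMr // ge_min lexx orbT.
have tK : t * K <= t * `|K| by rewrite ler_wpM2l ?ler_norm // ltW.
by rewrite mulrDr mulr1 in tD; lra.
Qed.

Section Subgradients.
Context {R : realType} {n : nat} (ip : {dot 'rV[R]_n for idfun}).
Context (X : set 'rV[R]_n).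

(** Minimize [f + mu * |. - y|^2] over a small ball of the affine hull around
    [y], which is compact although [X] is not assumed closed. For [mu] large the
    penalty on the boundary sphere exceeds the oscillation of [f], so the
    minimizer [w] is inside the ball and the first-order condition holds on all
    of [X], with subgradient [2 mu (y - w)]. The sign of [ip g (y - w)] is what
    survives when [w] tends to [y] while [g] may be unbounded. *)
Lemma subgradient_near (f : 'rV[R]_n -> R) m (A : 'M[R]_(m, n)) y (d : R) :
  convex_function X f -> {within X, continuous f} ->
  row_free A -> (forall x x', X x -> X x' -> (x - x' <= A)%MS) ->
  rel_interior X A y -> 0 < d ->
  exists w g, [/\ X w, is_subgradient ip X f w g, `|w - y| <= d
    & 0 <= ip g (y - w)].
Proof.
move=> fconv fcont freeA XA [r r_gt0 yr] d_gt0.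
have [C C_gt0 AC] := mulmxr_le_norm A.
pose rho := Num.min r (d / C).
have rho_gt0 : 0 < rho by rewrite lt_min r_gt0 divr_gt0.
have rho_r : rho <= r by rewrite ge_min lexx.
pose B := [set a : 'rV[R]_m | `|a| <= rho].
have B0 : B !=set0 by exists 0; rewrite /B/= normr0 ltW.
have cB : compact B := @closed_ball_compact _ _ rho.
have BX a : B a -> X (y + a *m A).
  by move=> aB; apply: yr; exact: le_trans rho_r.
pose phi a := f (y + a *m A).
have phic : {within B, continuous phi}.
  apply/subspace_continuousP => a Ba P Pn.
  have hc : (fun b : 'rV[R]_m => y + b *m A) @ a --> y + a *m A.
    exact: (cvgD (cvg_cst y) (@continuous_mulmxr _ _ _ A a)).
  move/subspace_continuousP : fcont => /(_ _ (BX _ Ba) _ Pn) /hc.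
  by apply: (@filterS _ _ (nbhs_filter a)) => b hb Bb; apply: hb; exact: BX.
pose q a := ip (a *m A) (a *m A).
have qc : continuous q.
  move=> a; have Aa : (fun b : 'rV[R]_m => b *m A) @ a --> a *m A.
    exact: continuous_mulmxr.
  exact: (@cvg_ip _ _ ip _ _ _ _ _ _ _ Aa Aa).
have q_gt0 a : a != 0 -> 0 < q a.
  by move=> a0; apply: neq0_dnorm_gt0; rewrite mulmx_free_eq0.
have [k k_gt0 qk] := sphere_lower_bound qc q_gt0 rho_gt0.
have [a0 Ba0 a0min] := compact_EVT_min B0 cB phic.
have B0' : 0 \in B by rewrite inE /B/= normr0 ltW.
pose mu := (phi 0 - phi a0 + 1) / k.
have mu_gt0 : 0 < mu by rewrite divr_gt0// ltr_wpDl// subr_ge0 a0min.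
have Gc : {within B, continuous (fun a => phi a + mu * q a)}.
  apply/subspace_continuousP => a Ba; apply: cvgD.
    by move/subspace_continuousP : phic; exact.
  apply: cvgM; first exact: cvg_cst.
  by move/continuous_subspaceT/subspace_continuousP : qc; exact.
have [a] := compact_EVT_min B0 cB Gc.
rewrite inE => Ba amin.
have a_lt : `|a| < rho.
  rewrite lt_neqAle [_ <= _]Ba andbT; apply/eqP => /qk ka.
  have := amin 0 B0'; rewrite {2}/q mul0mx ip0l mulr0 addr0 => a1.
  have a2 := a0min a (mem_set Ba).
  have : mu * k <= mu * q a by rewrite ler_wpM2l// ltW.
  rewrite /mu divfK ?gt_eqF//.
  move: (mu * q a) a1 => s; lra.
set w := y + a *m A.
have Xw : X w by exact: BX.
exists w, ((2 * mu) *: (y - w)); split.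
- by [].
- move=> x Xx.
  have /submxP[b xw] : (x - w <= A)%MS := XA _ _ Xx (BX _ Ba).
  have b1 : 0 < `|b| + 1 by rewrite ltr_wpDl.
  (* a step [t <= t0] towards [x] stays in the ball, where [a] is a minimizer *)
  pose t0 := Num.min 1 ((rho - `|a|) / (`|b| + 1)).
  have t0_gt0 : 0 < t0 by rewrite lt_min ltr01 divr_gt0 ?subr_gt0.
  rewrite -subr_ge0.
  apply: (ge0_of_small_slope (K := mu * ip (x - w) (x - w)) t0_gt0).
  move=> t /andP[t_gt0]; rewrite le_min => /andP[t1 tb].
  have Bt : a + t *: b \in B.
    rewrite inE /B/= (le_trans (ler_normD _ _))// -lerBrDl normrZ gtr0_norm//.
    rewrite ler_pdivlMr// mulrDr mulr1 in tb.
    by rewrite (le_trans _ tb)// lerDl ltW.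
  have := amin _ Bt.
  have -> : q (a + t *: b) =
      q a + t * (2 * ip (a *m A) (x - w) + t * ip (x - w) (x - w)).
    rewrite /q mulmxDl -scalemxAl -xw; move: (x - w) (a *m A) => v u.
    by rewrite !ipE (ipC ip v u); ring.
  have wt : phi (a + t *: b) <= (1 - t) * f w + t * f x.
    rewrite /phi mulmxDl -scalemxAl -xw addrA.
    rewrite [X in f X](_ : _ = (1 - t) *: w + t *: x).
      by apply: convex_function_segment => //; by rewrite ltW.
    by apply/rowP => j; rewrite !mxE; ring.
  have -> : phi a = f w by [].
  rewrite ip_scalel.
  have -> : ip (y - w) (x - w) = - ip (a *m A) (x - w).
    by rewrite -ip_oppl; congr (ip _ _); rewrite /w opprD addrA subrr add0r.
  move: (ip (a *m A) _) (ip (x - w) _) => u v h.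
  rewrite -(pmulr_rge0 _ t_gt0).
  move: h wt; move: (phi _) (q a) => p1 p2; lra.
- rewrite /w addrC addKr (le_trans (AC _))// mulrC -ler_pdivlMr//.
  by rewrite (le_trans (ltW a_lt))// ge_min lexx orbT.
- rewrite ip_scalel; apply: mulr_ge0; first by rewrite mulr_ge0// ltW.
  by have [->|h] := eqVneq (y - w) 0; rewrite ?ip0l// ltW// neq0_dnorm_gt0.
Qed.

End Subgradients.

(** * Limits along sequences *)

Section Sequences.
Context {R : realType} {n : nat}.
Implicit Types (u : nat -> 'rV[R]_n) (x : 'rV[R]_n).

Lemma within_continuous_cvg_seq (V : topologicalType) (f : 'rV[R]_n -> V)
    (D : set 'rV[R]_n) u x :
  {within D, continuous f} -> D x -> (forall k, D (u k)) ->
  u @ \oo --> x -> (fun k => f (u k)) @ \oo --> f x.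
Proof.
move=> /subspace_continuousP fc Dx Du ux P /(fc _ Dx) /ux.
by apply: (@filterS _ _ eventually_filter) => k; exact.
Qed.

Lemma cvg_seq_of_dist_le_inv (u : nat -> 'rV[R]_n) x :
  (forall k, `|u k - x| <= k.+1%:R^-1) -> u @ \oo --> x.
Proof.
move=> ux; apply/cvgrPdist_le => e e_gt0.
have /cvgrPdist_le/(_ e e_gt0) : @harmonic R @ \oo --> 0 by exact: cvg_harmonic.
apply: filterS => k; rewrite sub0r normrN ger0_norm ?invr_ge0// => he.
by rewrite distrC (le_trans (ux k)).
Qed.

Lemma le_of_harmonic_error (a b c : R) :
  (forall k : nat, a <= b + c * k.+1%:R^-1) -> a <= b.
Proof.
move=> h; have lim : (fun k : nat => b + c * k.+1%:R^-1) @ \oo --> b + c * 0.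
  apply: cvgD; first exact: cvg_cst.
  by apply: cvgM; [exact: cvg_cst|exact: cvg_harmonic].
rewrite -[b]addr0 -(mulr0 c).
by apply: (ler_cvg_to (@cvg_cst _ a nat \oo _) lim); exact: nearW.
Qed.

End Sequences.

(** * The distance-generating function *)

Section ProximalSetup.
Context {R : realType} {n : nat} (ip : {dot 'rV[R]_n for idfun}).
Context (X : set 'rV[R]_n) (convX : convex_set X) (S : proximal_setup ip X).
Implicit Types (x y z u w : 'rV[R]_n).
Local Notation omega := (dgf S).
Local Notation domega := (ddgf S).
Local Notation N := (pnorm S).
Local Notation Z := (subdiff_dom ip X omega).
Local Notation V := (bregman ip omega domega).

Lemma is_subgradient_monotone (f : 'rV[R]_n -> R) z w g h :
  X z -> X w -> is_subgradient ip X f z g -> is_subgradient ip X f w h ->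
  0 <= ip (h - g) (w - z).
Proof.
move=> Xz Xw /(_ _ Xw) gz /(_ _ Xz) hw; move: gz hw; rewrite !ipE; lra.
Qed.

Lemma subdiff_dom_dense y (d : R) : X y -> 0 < d ->
  exists2 w, Z w & `|w - y| <= d.
Proof.
move=> Xy d_gt0.
have [|m [A [c [freeA rA XA]]]] := exists_rel_interior convX; first by exists y.
have d2 : 0 < d / 2 by rewrite divr_gt0.
pose e := Num.min 1 (d / 2 / (`|c - y| + 1)).
have cy1 : 0 < `|c - y| + 1 by rewrite ltr_wpDl.
have e_gt0 : 0 < e by rewrite lt_min ltr01 divr_gt0.
have e01 : 0 < e <= 1 by rewrite e_gt0 ge_min lexx.
have [w [g [Xw gw wy _]]] := subgradient_near ip (dgf_convex S)
  (@dgf_continuous _ _ _ _ S) freeA XA (rel_interior_segment convX rA Xy e01) d2.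
exists w; first by split=> //; exists g.
set y' := (1 - e) *: y + e *: c in wy.
rewrite -(subrK y' w) -addrA (le_trans (ler_normD _ _))//.
have -> : y' - y = e *: (c - y).
  by rewrite /y'; apply/rowP => j; rewrite !mxE; ring.
rewrite normrZ gtr0_norm//.
have : e * (`|c - y| + 1) <= d / 2 by rewrite -ler_pdivlMr// ge_min lexx orbT.
rewrite mulrDr mulr1; lra.
Qed.

(** Among all subgradients at [z], the continuous selection is the largest in
    every feasible direction. Choose points of the subdifferential domain within
    [t^2] of [z + t (u - z)]: monotonicity of subgradients between them and [z],
    divided by [t], passes to the limit by continuity of the selection. *)
Lemma subgradient_le_ddgf z g u : Z z -> is_subgradient ip X omega z g -> X u ->
  ip g (u - z) <= ip (domega z) (u - z).
Proof.
move=> Zz gz Xu; have [Xz _] := Zz.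
pose t (k : nat) : R := k.+1%:R^-1.
have t_gt0 k : 0 < t k by rewrite invr_gt0.
have t_le1 k : t k <= 1 by rewrite invf_le1// ler1n.
pose p k := (1 - t k) *: z + t k *: u.
have Xp k : X (p k) by apply: convex_set_segment => //; rewrite ltW ?t_le1.
have /choice[w hw] k : exists w, Z w /\ `|w - p k| <= t k * t k.
  have [||w] := @subdiff_dom_dense (p k) (t k * t k); rewrite ?mulr_gt0//.
  by exists w.
have dir : (fun k => (t k)^-1 *: (w k - z)) @ \oo --> u - z.
  apply: cvg_seq_of_dist_le_inv => k; have [_] := hw k.
  have -> : (t k)^-1 *: (w k - z) - (u - z) = (t k)^-1 *: (w k - p k).
    rewrite -[u - z](scalerK (lt0r_neq0 (t_gt0 k))) -scalerBr; congr (_ *: _).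
    by apply/rowP => j; rewrite !mxE; ring.
  by rewrite normrZ gtr0_norm ?invr_gt0// -ler_pdivlMl ?invr_gt0// invrK.
have wz : w @ \oo --> z.
  have -> : w = (fun k => z + t k *: ((t k)^-1 *: (w k - z))).
    by apply/funext => k; rewrite scalerA divff ?gt_eqF// scale1r addrC subrK.
  suff : (fun k => z + t k *: ((t k)^-1 *: (w k - z))) @ \oo --> z + 0 *: (u - z).
    by rewrite scale0r addr0.
  by apply: cvgD; [exact: cvg_cst|apply: cvgZ => //; exact: cvg_harmonic].
have dw : (fun k => domega (w k)) @ \oo --> domega z.
  apply: (within_continuous_cvg_seq (@ddgf_continuous _ _ _ _ S) Zz _ wz) => k.
  by case: (hw k).
have lim : (fun k => ip (domega (w k) - g) ((t k)^-1 *: (w k - z))) @ \oo -->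
    ip (domega z - g) (u - z).
  by apply: cvg_ip => //; apply: cvgB => //; exact: cvg_cst.
rewrite -subr_ge0 -ip_oppl -ip_addl -(cvg_lim _ lim)//.
apply: limr_ge; first by apply/cvg_ex; eexists; exact: lim.
apply: nearW => k; rewrite ip_scaler; apply: mulr_ge0; first by rewrite invr_ge0 ltW.
have [[Xw hwk] _] := hw k.
by apply: (is_subgradient_monotone Xz Xw gz); apply: ddgf_subgradient.
Qed.

(** Strong monotonicity of the selection, transported to a relative interior
    point [p]. Subgradients are only at hand at points [w] tending to [p], and may
    be unbounded there, but [ip (domega w) (p - w) >= 0] by the choice of [w]:
    both error terms coming from [p - w] have the favourable sign and can be
    dropped before passing to the limit. *)
Lemma ddgf_strong_step m (A : 'M[R]_(m, n)) z p p' (s : R) :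
  row_free A -> (forall x x', X x -> X x' -> (x - x' <= A)%MS) ->
  Z z -> rel_interior X A p -> X p' -> 0 <= s -> p' - p = s *: (p - z) ->
  omega p + s * (ip (domega z) (p - z) + N (p - z) ^+ 2) <= omega p'.
Proof.
move=> freeA XA Zz rp Xp' s_ge0 pE.
have Xp := rel_interior_sub rp.
have /choice[w hw] (k : nat) : exists w, exists g,
    [/\ X w, is_subgradient ip X omega w g, `|w - p| <= k.+1%:R^-1
      & 0 <= ip g (p - w)].
  apply: (subgradient_near ip (dgf_convex S) (@dgf_continuous _ _ _ _ S)
    freeA XA rp).
  by rewrite invr_gt0.
have wp : w @ \oo --> p.
  by apply: cvg_seq_of_dist_le_inv => k; have [g []] := hw k.
have wz : (fun k => w k - z) @ \oo --> p - z by apply: cvgB => //; exact: cvg_cst.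
have omw : (fun k => omega (w k)) @ \oo --> omega p.
  apply: (within_continuous_cvg_seq (@dgf_continuous _ _ _ _ S) Xp _ wp) => k.
  by have [g []] := hw k.
have Nw : (fun k => N (w k - z)) @ \oo --> N (p - z).
  exact: (cvg_comp _ _ wz (is_norm_continuous (pnorm_norm S) (x := p - z))).
have lim : (fun k => omega (w k)
      + s * (ip (domega z) (w k - z) + N (w k - z) ^+ 2)) @ \oo -->
    omega p + s * (ip (domega z) (p - z) + N (p - z) ^+ 2).
  apply: cvgD => //; apply: cvgM; first exact: cvg_cst.
  by apply: cvgD; [apply: cvg_ip => //; exact: cvg_cst|exact: cvgM].
apply: (ler_cvg_to lim (@cvg_cst _ (omega p') nat \oo _)); apply: nearW => k.
have [g [Xw gw _ g_ge0]] := hw k.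
have Zw : Z (w k) by split=> //; exists g.
have d_ge0 := le_trans g_ge0 (subgradient_le_ddgf Zw gw Xp).
have strong := ddgf_strong Zw Zz.
have := ddgf_subgradient Zw Xp'.
have -> : p' - w k = (p - w k) + s *: (p - z) by rewrite -pE [RHS]addrC subrKA.
rewrite ip_addr ip_scaler.
have -> : p - z = (p - w k) + (w k - z) by rewrite addrA subrK.
rewrite ip_addr.
have h : s * (ip (domega z) (w k - z) + N (w k - z) ^+ 2)
   <= s * (ip (domega (w k)) (p - w k) + ip (domega (w k)) (w k - z)).
  apply: ler_wpM2l => //; move: strong; rewrite ip_addl ip_oppl.
  by move: d_ge0; lra.
by move: h d_ge0; lra.
Qed.

(** Summing the previous estimate over a uniform subdivision of the segment from
    [z] to [z'] into [k + 1] pieces integrates the derivative of [omega] along it,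
    and gives the bound up to an error of order [1 / (k + 1)]. *)
Lemma bregman_ge_rel_interior m (A : 'M[R]_(m, n)) z z' :
  row_free A -> (forall x x', X x -> X x' -> (x - x' <= A)%MS) ->
  Z z -> rel_interior X A z' -> N (z' - z) ^+ 2 / 2 <= V z z'.
Proof.
move=> freeA XA Zz rz'; have [Xz _] := Zz.
set d := z' - z; pose a := ip (domega z) d; pose b := N d ^+ 2.
suff : omega z + a + b / 2 <= omega z'.
  by rewrite /bregman -/d -/a -/b; lra.
apply: (@le_of_harmonic_error _ _ _ (b / 2)) => k.
have k_gt0 : (0 : R) < k.+1%:R by [].
pose p (j : nat) := (1 - j%:R / k.+1%:R) *: z + (j%:R / k.+1%:R) *: z'.
have pz j : p j - z = (j%:R / k.+1%:R) *: d.
  by apply/rowP => i; rewrite !mxE; ring.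
have p0 : p 0%N = z by rewrite /p mul0r subr0 scale1r scale0r addr0.
have pk : p k.+1 = z' by rewrite /p divff ?gt_eqF// subrr scale0r add0r scale1r.
have rp j : (0 < j <= k.+1)%N -> rel_interior X A (p j).
  move=> /andP[j_gt0 jk]; apply: rel_interior_segment => //.
  by rewrite divr_gt0 ?ltr0n// ler_pdivrMr// mul1r ler_nat.
have Nscale (c : R) : 0 <= c -> N (c *: d) ^+ 2 = c ^+ 2 * b.
  by move=> c0; rewrite (is_norm_scale (pnorm_norm S)) ger0_norm// exprMn.
(* [j (j - 1) / 2] is [0 + ... + (j - 1)], the total gain of the first [j] steps *)
have step j : (j <= k.+1)%N ->
    omega z + j%:R / k.+1%:R * a
      + j%:R * (j%:R - 1) / 2 / k.+1%:R ^+ 2 * b <= omega (p j).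
  elim: j => [_|j IH jk]; first by rewrite p0 !mul0r !addr0.
  have Xp : X (p j.+1) by apply: rel_interior_sub (rp j.+1 _); rewrite jk.
  have {IH} := IH (ltnW jk).
  case: (posnP j) => [j0|j_gt0] IH.
    (* at [p 0 = z] there is no slope to gain: the subgradient inequality *)
    rewrite j0 in Xp *; have := ddgf_subgradient Zz Xp; rewrite pz ip_scaler -/a.
    by rewrite subrr mulr0 !mul0r addr0.
  have rpj : rel_interior X A (p j) by apply: rp; rewrite j_gt0 ltnW.
  have j0 : (0 : R) < j%:R by rewrite ltr0n.
  have := @ddgf_strong_step _ A z (p j) (p j.+1) j%:R^-1 freeA XA Zz rpj Xp.
  rewrite invr_ge0 ler0n pz scalerA mulrA mulVf ?gt_eqF// mul1r => /(_ isT).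
  have -> : p j.+1 - p j = k.+1%:R^-1 *: d.
    rewrite -(subrKA z) -[z - p j]opprB !pz -scalerBl -mulrBl -natr1.
    by rewrite addrC addKr mul1r.
  move=> /(_ erefl); rewrite ip_scaler -/a Nscale ?divr_ge0// => h.
  apply: le_trans h; apply: le_trans (lerD IH (lexx _)).
  rewrite -natr1 le_eqVlt; apply/orP; left; apply/eqP.
  by field; rewrite !gt_eqF.
have := step _ (leqnn k.+1); rewrite pk divff ?gt_eqF// mul1r.
move=> h; rewrite -lerBlDr; apply: le_trans h; rewrite le_eqVlt; apply/orP; left.
by apply/eqP; field; rewrite gt_eqF.
Qed.

(** Any [u] in [X] is a limit of relative interior points, and [V z] is continuous
    on [X]. *)
Lemma bregman_ge z u : Z z -> X u -> N (u - z) ^+ 2 / 2 <= V z u.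
Proof.
move=> Zz Xu.
have [|m [A [c [freeA rA XA]]]] := exists_rel_interior convX; first by exists u.
pose t (k : nat) : R := k.+1%:R^-1.
have t01 k : 0 < t k <= 1 by rewrite invr_gt0 invf_le1// ltr0n ler1n.
pose w k := (1 - t k) *: u + t k *: c.
have rw k : rel_interior X A (w k) by exact: rel_interior_segment.
have wu : w @ \oo --> u.
  suff : w @ \oo --> (1 - 0) *: u + 0 *: c by rewrite subr0 scale1r scale0r addr0.
  have t0 : t @ \oo --> 0 by exact: cvg_harmonic.
  apply: cvgD; apply: cvgZ; try exact: cvg_cst; last by [].
  by apply: cvgB => //; exact: cvg_cst.
have wz : (fun k => w k - z) @ \oo --> u - z by apply: cvgB => //; exact: cvg_cst.
have Nw : (fun k => N (w k - z)) @ \oo --> N (u - z).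
  exact: (cvg_comp _ _ wz (is_norm_continuous (pnorm_norm S) (x := u - z))).
have omw : (fun k => omega (w k)) @ \oo --> omega u.
  apply: (within_continuous_cvg_seq (@dgf_continuous _ _ _ _ S) Xu _ wu) => k.
  exact: rel_interior_sub (rw k).
have l1 : (fun k => N (w k - z) ^+ 2 / 2) @ \oo --> N (u - z) ^+ 2 / 2.
  by apply: cvgM; [exact: cvgM|exact: cvg_cst].
have l2 : (fun k => V z (w k)) @ \oo --> V z u.
  apply: cvgB; first by apply: cvgB => //; exact: cvg_cst.
  by apply: cvg_ip => //; exact: cvg_cst.
apply: (ler_cvg_to l1 l2); apply: nearW => k.
exact: bregman_ge_rel_interior (rw k).
Qed.

Lemma bregman_ge0 z u : Z z -> X u -> 0 <= V z u.
Proof. by move=> Zz Xu; rewrite subr_ge0 lerBrDl; exact: ddgf_subgradient. Qed.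

(** * Mirror-prox steps *)

(** Optimality of the prox point says that [domega z - xi] is a subgradient of
    [omega] there; comparing it with the selected subgradient by
    [subgradient_le_ddgf] gives the variational inequality, which is this
    three-point inequality rearranged. *)
Lemma prox_three_point z xi u : Z z -> X u ->
  ip xi (prox S z xi - u) <= V z u - V (prox S z xi) u - V z (prox S z xi).
Proof.
move=> Zz Xu; set w := prox S z xi.
have Zw : Z w by exact: prox_subdiff_dom.
have gw : is_subgradient ip X omega w (domega z - xi).
  move=> y Xy; have [_ /(_ _ Xy)] := prox_argmin xi Zz.
  by rewrite /= -/w /bregman !ipE; lra.
have := subgradient_le_ddgf Zw gw Xu.
by rewrite /bregman !ipE; lra.
Qed.

(** Split [ip eta (w - u)] as [ip eta (z' - u) + ip xi (w - z')
    + ip (eta - xi) (w - z')], where [z'] is the second prox point. The three-point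
    inequality bounds the first two terms, and its negative Bregman terms
    [V z w] and [V w z'], bounded below by strong convexity, absorb the third. *)
Lemma extragradient_step z xi eta u (w := prox S z xi) :
  Z z -> X u ->
  (forall d, ip (eta - xi) d <= N (w - z) * N d) ->
  ip eta (w - u) <= V z u - V (prox S z eta) u.
Proof.
move=> Zz Xu lip; set z' := prox S z eta.
have Zw : Z w by exact: prox_subdiff_dom.
have Zz' : Z z' by exact: prox_subdiff_dom.
have h1 := prox_three_point eta Zz Xu.
have h2 := prox_three_point xi Zz Zz'.1.
have h3 := bregman_ge Zz Zw.1.
have h4 := bregman_ge Zw Zz'.1.
have h5 := lip (w - z').
have h6 : N (w - z') = N (z' - w) by rewrite -opprB is_normN//; exact: pnorm_norm.
have h7 : 0 <= (N (w - z) - N (w - z')) ^+ 2 by exact: sqr_ge0.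
move: h1 h2 h3 h4 h5 h7; rewrite -/w -/z' -h6 !ipE.
by move: (N (w - z)) (N (w - z')) => a b; rewrite !expr2; lra.
Qed.

End ProximalSetup.

(** * The regret bound *)

Theorem theorem4 (R : realType) (n : nat) (ip : {dot 'rV[R]_n for idfun})
  (X : set 'rV[R]_n) (convX : convex_set X) (S : proximal_setup ip X)
  (T : nat) (T_ge1 : (1 <= T)%N)
  (f : 'I_T -> 'rV[R]_n -> R) (df : 'I_T -> 'rV[R]_n -> 'rV[R]_n)
  (f_convex : forall t, convex_function X (f t))
  (df_subgradient : forall t x, X x -> is_subgradient ip X (f t) x (df t x))
  (L : R) (L_gt0 : 0 < L)
  (df_lipschitz : forall t x u, X x -> X u ->
    dual_norm ip (pnorm S) (df t x - df t u) <= L * pnorm S (x - u))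
  (theta : 'I_T -> R) (theta_simplex : simplex theta)
  (gamma : 'I_T -> R)
  (gammaE : forall t, gamma t = 1 / (L * sup (range theta)))
  (x : 'I_T -> 'rV[R]_n) (v : nat -> 'rV[R]_n)
  (v0E : v 0%N = omega_center S)
  (xE : forall t : 'I_T,
    x t = prox S (v t) ((gamma t * theta t) *: df t (v t)))
  (vSE : forall t : 'I_T,
    v t.+1 = prox S (v t) ((gamma t * theta t) *: df t (x t))) :
  ((\sum_(t < T) theta t * f t (x t))%:E
     - ereal_inf [set (\sum_(t < T) theta t * f t y)%:E | y in X]
   <= (set_width S * L * sup (range theta))%:E)%E.
Proof.
have [theta_ge0 theta_sum] := theta_simplex.
set M := sup (range theta).
have theta_leM t : theta t <= M.
  apply: sup_upper_bound; last by exists t.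
  split; first by exists (theta t), t.
  exists 1 => _ [s _ <-]; rewrite -theta_sum (bigD1 s)//= lerDl.
  exact: sumr_ge0.
have M_gt0 : 0 < M.
  rewrite ltNge; apply/negP => M_le0.
  have : \sum_(t < T) theta t <= 0.
    by apply: sumr_le0 => t _; exact: le_trans (theta_leM t) M_le0.
  by rewrite theta_sum ler10.
have LM_gt0 : 0 < L * M by exact: mulr_gt0.
have {}gammaE t : gamma t = (L * M)^-1 by rewrite gammaE div1r.
have weight_ge0 t : 0 <= gamma t * theta t.
  by rewrite gammaE mulr_ge0// invr_ge0 ltW.
have weight_le t : gamma t * theta t * L <= 1.
  rewrite gammaE mulrAC -mulrA ler_pdivrMl// mulr1.
  by rewrite ler_pM2l.
have Zv0 : subdiff_dom ip X (dgf S) (v 0%N).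
  have [Xc cmin] := omega_center_argmin S.
  rewrite v0E; split=> //; exists 0 => y Xy.
  by rewrite ip0l addr0 cmin.
have Zv (k : nat) : (k <= T)%N -> subdiff_dom ip X (dgf S) (v k).
  elim: k => // k IH kT; rewrite (vSE (Ordinal kT)).
  by apply: prox_subdiff_dom; apply: IH; exact: ltnW.
have Zvt (t : 'I_T) : subdiff_dom ip X (dgf S) (v t) by apply: Zv; exact: ltnW.
have Xx t : X (x t).
  by rewrite xE; apply: (proj1 (prox_subdiff_dom _ _)).
suff regret u : X u ->
    \sum_(t < T) theta t * f t (x t) - \sum_(t < T) theta t * f t u
    <= set_width S * L * M.
  set a := \sum_(t < T) _; set b := _ * M.
  have : ((a - b)%:E
      <= ereal_inf [set (\sum_(t < T) theta t * f t y)%:E | y in X])%E.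
    apply: le_ereal_inf_tmp => _ [y Xy <-].
    by rewrite lee_fin lerBlDr -lerBlDl regret.
  case: ereal_inf => [r|_|]; last by rewrite leeNy_eq.
    by rewrite -EFinB !lee_fin !lerBlDr addrC.
  by rewrite leNye.
move=> Xu.
pose W k := bregman ip (dgf S) (ddgf S) (v k) u.
have step (t : 'I_T) : gamma t * theta t * (f t (x t) - f t u) <= W t - W t.+1.
  have fxu : f t (x t) - f t u <= ip (df t (x t)) (x t - u).
    have := df_subgradient t _ (Xx t) _ Xu.
    by rewrite !ipE; lra.
  apply: le_trans (ler_wpM2l (weight_ge0 t) fxu) _.
  rewrite -ip_scalel /W vSE xE; apply: extragradient_step => // d.
  rewrite -xE -scalerBr ip_scalel.
  have lip : ip (df t (x t) - df t (v t)) d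
      <= L * pnorm S (x t - v t) * pnorm S d.
    apply: le_trans (dual_norm_bound ip _ _ (pnorm_norm S)) _.
    apply: ler_wpM2r; first exact: is_norm_ge0 (pnorm_norm S).
    by apply: df_lipschitz => //; case: (Zvt t).
  apply: le_trans (ler_wpM2l (weight_ge0 t) lip) _.
  rewrite !mulrA -mulrA ler_piMl//.
  by apply: mulr_ge0; exact: is_norm_ge0 (pnorm_norm S).
have : \sum_(t < T) gamma t * theta t * (f t (x t) - f t u) <= W 0%N - W T.
  apply: le_trans (ler_sum _ (fun t _ => step t)) _.
  rewrite -(big_mkord xpredT (fun t => W t - W t.+1)).
  rewrite (@telescope_sumr_eq _ 0 T (fun t => - W t))// => [|k _];
    by rewrite opprK addrC.
have -> : \sum_(t < T) gamma t * theta t * (f t (x t) - f t u) =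
    (L * M)^-1 * (\sum_(t < T) theta t * f t (x t) - \sum_(t < T) theta t * f t u).
  rewrite -sumrB mulr_sumr; apply: eq_bigr => t _.
  by rewrite gammaE -mulrA mulrBr.
have W0 : W 0%N <= set_width S.
  by have [_] := set_width_max S; apply; exists u => //; rewrite /W v0E.
have WT : 0 <= W T by exact: bregman_ge0 (Zv T (leqnn T)) Xu.
rewrite ler_pdivrMl// => /le_trans; apply.
by rewrite -mulrA [leRHS]mulrC ler_pM2l//; lra.
Qed.
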